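(* For each integer $n\ge 2$ let $\varrho_e=\varrho_e(n)\in[0,1]$ and let $p_{i,j}=p_{i,j}(n)\in[0,1]$ for $\{i,j\}\in\binom{[n]}{2}$, with mean $\mu=\mu(n)$, and suppose there are constants $0<a\le b<1$ with $a\le\mu(n)\le b$ for all $n$. For each $n$, let $G=G_n$ and $H=H_n$ be $\varrho_e$-correlated random Bernoulli$(\{p_{i,j}\})$ graphs on the vertex set $[n]$, all defined on a common probability space, let $\mathcal I$ be the identity bijection of $[n]$, and let $\varrho_T=\varrho_T(n)$ be the total correlation. Then, as $n\to\infty$, $$\mathfrak{str}(G,H,\mathcal I)-\varrho_T\to 0\quad\text{almost surely}.$$
   Context: $[n]:=\{1,\dots,n\}$; $\binom{[n]}{2}$ is the set of all $2$-element subsets of $[n]$; $\Pi_n$ is the set of all bijections $[n]\to[n]$; $i\sim_G j$ means $i$ and $j$ are adjacent in $G$; $\mathbf 1(\cdot)$ is the indicator function. Graphs are simple and undirected. Correlated Bernoulli graphs: given $\varrho_e\in[0,1]$ (edge correlation) and numbers $p_{i,j}\in[0,1]$, $\{i,j\}\in\binom{[n]}{2}$ (Bernoulli parameters), not all $0$ and not all $1$, random graphs $G,H$ on vertex set $[n]$ are called $\varrho_e$-correlated random Bernoulli$(\{p_{i,j}\})$ graphs if for each $\{i,j\}\in\binom{[n]}{2}$ the variables $\mathbf 1(i\sim_G j)$ and $\mathbf 1(i\sim_H j)$ are each Bernoulli$(p_{i,j})$ and, if $0<p_{i,j}<1$, have Pearson correlation coefficient $\varrho_e$; other than these dependencies,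 the random variables $\{\mathbf 1(i\sim_G j)\}\cup\{\mathbf 1(i\sim_H j)\}$ are collectively independent (that is, the pairs $(\mathbf 1(i\sim_G j),\mathbf 1(i\sim_H j))$ are independent over $\{i,j\}\in\binom{[n]}{2}$). The mean and variance of the Bernoulli parameters are $\mu:=\binom n2^{-1}\sum_{\{i,j\}\in\binom{[n]}{2}}p_{i,j}$ and $\sigma^2:=\binom n2^{-1}\sum_{\{i,j\}\in\binom{[n]}{2}}(p_{i,j}-\mu)^2$. The heterogeneity correlation is $\varrho_h:=\dfrac{\sigma^2}{\mu(1-\mu)}$, and the total correlation $\varrho_T$ is defined by $1-\varrho_T:=(1-\varrho_e)(1-\varrho_h)$. For $\phi\in\Pi_n$, the number of disagreements between $G$ and $H$ under $\phi$ is $$d(G,H,\phi):=\sum_{\{i,j\}\in\binom{[n]}{2}}\mathbf 1\Big(\mathbf 1(i\sim_G j)\neq \mathbf 1(\phi(i)\sim_H\phi(j))\Big),$$ and the alignment strength of $\phi$ is $$\mathfrak{str}(G,H,\phi):=1-\frac{d(G,H,\phi)}{\frac1{n!}\sum_{\phi'\in\Pi_n}d(G,H,\phi')}.$$ The alignment strength is undefined when $G$ and $H$ are both edgeless or both complete; on that event assign it the value $0$ by convention. All parameters depend on $n$; no assumption is made on the dependence between the graph pairs for different values of $n$. *)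

(* Defs.v *)
From HB Require Import structures.
From mathcomp Require Import all_boot all_order all_algebra fingroup perm.
From mathcomp Require Import all_classical all_reals all_analysis.

Set Implicit Arguments.
Unset Strict Implicit.
Unset Printing Implicit Defensive.

Import Order.TTheory GRing.Theory Num.Theory.
Import numFieldNormedType.Exports.

Local Open Scope classical_set_scope.
Local Open Scope ring_scope.

(* The vertex set [n] is 'I_n. *)
Definition pairs (n : nat) : {set {set 'I_n}} :=
  [set e : {set 'I_n} | #|e| == 2%N]%SET.

(* i and j are adjacent when [set i; j] is an edge. *)
Record sgraph (n : nat) := SGraph {
  edges : {set {set 'I_n}};
  edges_pairs : edges \subset pairs n }.

Section Alignment.
Variables (R : realType) (n : nat).
Implicit Types (g h : sgraph n) (phi : 'S_n).

(* A bijection phi sends the pair {i, j} to its image {phi i, phi j}. *)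
Definition disagreements g h phi : nat :=
  (\sum_(e in pairs n) ((e \in edges g) != ((phi @: e)%SET \in edges h)))%N.

Definition mean_disagreements g h : R :=
  (n`!%:R)^-1 * \sum_(phi : 'S_n) (disagreements g h phi)%:R.

(* The degenerate pairs of graphs are those whose mean number of disagreements
   vanishes; they get the conventional value 0, and not the value 1 that
   division by zero would give. *)
Definition str g h phi : R :=
  if (edges g == finset.set0) && (edges h == finset.set0)
     || (edges g == pairs n) && (edges h == pairs n) then 0
  else 1 - (disagreements g h phi)%:R / mean_disagreements g h.

End Alignment.

(* The number p_{i,j} is p [set i; j]; the values of p on sets that
   are not pairs are never used. *)
Section Correlations.
Variables (R : realType) (n : nat) (p : {set 'I_n} -> R).

Definition bmean : R := ('C(n, 2)%:R)^-1 * \sum_(e in pairs n) p e.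

Definition bvariance : R :=
  ('C(n, 2)%:R)^-1 * \sum_(e in pairs n) (p e - bmean) ^+ 2.

Definition het_correlation : R := bvariance / (bmean * (1 - bmean)).

(* Solved from 1 - rhoT = (1 - rhoe) * (1 - rhoh). *)
Definition total_correlation (rhoe : R) : R :=
  1 - (1 - rhoe) * (1 - het_correlation).

End Correlations.

Section Probability.
Variables (R : realType) (d : measure_display) (T : measurableType d).
Variable P : probability T R.

Definition pearson (X Y : T -> R) : R :=
  fine (covariance P X Y) / Num.sqrt (fine ('V_P[X]) * fine ('V_P[Y])).

(* Mutual independence of the family (X i), i in A; the values lie in a finite
   discrete space V, all of whose subsets are measurable. *)
Definition mutually_independent (I : finType) (A : {set I}) (V : finType)
    (X : I -> T -> V) : Prop :=
  forall (S : {set I}) (B : I -> set V), S \subset A ->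
    P (\bigcap_(i in [set` S]) (X i @^-1` B i)) =
    (\prod_(i in S) fine (P (X i @^-1` B i)))%:E.

Definition edge_event (n : nat) (G : T -> sgraph n) (e : {set 'I_n}) : set T :=
  [set w | e \in edges (G w)].

Record correlated_bernoulli (n : nat) (rhoe : R) (p : {set 'I_n} -> R)
    (G H : T -> sgraph n) : Prop := CorrelatedBernoulli {
  cb_rhoe : 0 <= rhoe <= 1;
  cb_p : forall e, e \in pairs n -> 0 <= p e <= 1;
  cb_not_all0 : exists2 e, e \in pairs n & p e != 0;
  cb_not_all1 : exists2 e, e \in pairs n & p e != 1;
  cb_measG : forall e, e \in pairs n -> measurable (edge_event G e);
  cb_measH : forall e, e \in pairs n -> measurable (edge_event H e);
  cb_bernoulliG : forall e, e \in pairs n -> P (edge_event G e) = (p e)%:E;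
  cb_bernoulliH : forall e, e \in pairs n -> P (edge_event H e) = (p e)%:E;
  cb_correlation : forall e, e \in pairs n -> 0 < p e < 1 ->
    pearson (\1_(edge_event G e)) (\1_(edge_event H e)) = rhoe;
  cb_independence : mutually_independent (pairs n)
    (fun e w => (e \in edges (G w), e \in edges (H w))) }.

End Probability.

(* Main.v *)
(* Let x and y be the edge densities of G and H. A uniform permutation sends a
   given pair to a uniform pair, so the mean number of disagreements is
   binom(n,2) (x (1 - y) + (1 - x) y), and the alignment strength of the
   identity is 1 - D / (x (1 - y) + (1 - x) y) with D the fraction of pairs on
   which G and H disagree. The quantities x, y and D are means of binom(n,2)
   pairwise independent indicators, hence have variance O(1/n^2). As this is
   summable, the sum over n of the squared deviations has a finite expectation
   and is almost surely finite, so the deviations tend to 0 almost surely; no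
   dependence between different n matters. Finally E x = E y = mu and
   E D = (1 - rho_T) 2 mu (1 - mu), where 2 mu (1 - mu) is bounded below. *)
Require Import Defs.
From mathcomp Require Import all_boot all_order all_algebra fingroup perm.
From mathcomp Require Import all_classical all_reals all_analysis.
From mathcomp Require Import measurable_realfun ring lra.
Import Order.TTheory GRing.Theory Num.Theory.
Import numFieldNormedType.Exports.
Local Open Scope classical_set_scope.
Local Open Scope ring_scope.

Set Implicit Arguments.
Unset Strict Implicit.
Unset Printing Implicit Defensive.

(** * Averaging disagreements over all permutations *)

Lemma card_pairs n : #|pairs n| = 'C(n, 2).
Proof. by rewrite card_draws card_ord. Qed.

Lemma imset_perm_pairs n (phi : 'S_n) (e : {set 'I_n}) :
  ((phi @: e)%SET \in pairs n) = (e \in pairs n).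
Proof. by rewrite !finset.inE card_imset //; exact: perm_inj. Qed.

Lemma perm_pairs_transitive n (e f : {set 'I_n}) :
  e \in pairs n -> f \in pairs n -> exists phi : 'S_n, (phi @: f)%SET = e.
Proof.
rewrite !finset.inE => /cards2P[a [b [ab ->]]] /cards2P[c [d [cd ->]]].
(* The left factor acts first and sends [c] to [a]; the second sends the image of [d] to [b]. It
   fixes [a], because [a != b] and, as [c != d], the image of [d] is not [a]. *)
exists (tperm c a * tperm (tperm c a d) b)%g.
rewrite imsetU1 imset_set1 !permM tpermL tpermL.
rewrite [tperm _ b a]tpermD //; last by rewrite eq_sym.
by rewrite -[X in _ != X](tpermL c a) (inj_eq perm_inj) eq_sym.
Qed.

(** By transitivity and translation in the group, the sum over [phi] is the same for every pair.
    Summing it over all pairs and exchanging the sums leaves, for each [phi], a sum over [pairs n]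
    that [phi] merely permutes. *)
Lemma sum_perm_pair (n : nat) (F : {set 'I_n} -> nat) (e : {set 'I_n}) :
  e \in pairs n ->
  ('C(n, 2) * \sum_(phi : 'S_n) F (phi @: e)%SET
   = n`! * \sum_(f in pairs n) F f)%N.
Proof.
move=> he.
have indep f : f \in pairs n ->
    (\sum_(phi : 'S_n) F (phi @: f)%SET = \sum_(phi : 'S_n) F (phi @: e)%SET)%N.
  move=> hf; have [psi <-] := perm_pairs_transitive he hf.
  rewrite (reindex_inj (mulgI psi)); apply: eq_bigr => phi _ /=.
  rewrite -imset_comp; congr F; apply: eq_imset => x; exact: permM.
rewrite -card_pairs -sum_nat_const -(eq_bigr _ indep) exchange_big /=.
rewrite (eq_bigr (fun=> \sum_(f in pairs n) F f)%N) => [|phi _].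
  by rewrite sum_nat_const card_Sn.
have inj : {in pairs n &, injective (fun f : {set 'I_n} => (phi @: f)%SET)}.
  by move=> f g _ _; exact/imset_inj/perm_inj.
rewrite -(big_imset F inj) /=; apply: eq_bigl.
suff -> : ((fun f : {set 'I_n} => (phi @: f)%SET) @: pairs n)%SET = pairs n by [].
apply/eqP; rewrite eqEcard (card_in_imset inj) leqnn andbT.
by apply/fintype.subsetP => _ /imsetP[f hf ->]; rewrite imset_perm_pairs.
Qed.

Lemma sum_mem_subset (I : finType) (A D : {set I}) :
  D \subset A -> (\sum_(e in A) (e \in D) = #|D|)%N.
Proof.
move=> DA; rewrite -{2}(finset.setIidPr DA) -sum1_card [RHS]big_mkcond [LHS]big_mkcond.
by apply: eq_bigr => i _; rewrite finset.inE; case: (i \in A); case: (i \in D).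
Qed.

(** Split on whether [e] lies in [B]: the inner sum then counts the [f] outside or inside [C]. The
    inclusions make the truncated subtractions exact. *)
Lemma sum_mem_neq (I : finType) (A B C : {set I}) :
  B \subset A -> C \subset A ->
  (\sum_(e in A) \sum_(f in A) ((e \in B) != (f \in C))
   = #|B| * (#|A| - #|C|) + (#|A| - #|B|) * #|C|)%N.
Proof.
move=> BA CA.
have sumI := @sum_mem_subset I A.
have sumN (D : {set I}) : D \subset A ->
    (\sum_(e in A) (e \notin D) = #|A| - #|D|)%N.
  move=> DA; rewrite -(sumI _ DA) -sum1_card -sumnB; last by move=> i; case: (i \in D).
  by apply: eq_bigr => i _; case: (i \in D).
rewrite -[X in (X * _ + _)%N](sumI B) // -[X in (_ + X * _)%N](sumN B) //.
rewrite !big_distrl /= -big_split /=; apply: eq_bigr => e _.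
case: (e \in B) => /=; rewrite ?mul1n ?mul0n ?addn0 ?add0n.
  by rewrite -sumN //; apply: eq_bigr => f _; case: (f \in C).
by rewrite -sumI //; apply: eq_bigr => f _; case: (f \in C).
Qed.

(** For each [e], [sum_perm_pair] replaces the average over permutations by an average over a free
    second pair [f]; [sum_mem_neq] then counts the disagreeing couples. *)
Lemma mean_disagreementsE (R : realType) n (g h : sgraph n) : (2 <= n)%N ->
  let x := ('C(n, 2)%:R)^-1 * #|edges g|%:R : R in
  let y := ('C(n, 2)%:R)^-1 * #|edges h|%:R : R in
  mean_disagreements R g h = 'C(n, 2)%:R * (x * (1 - y) + (1 - x) * y).
Proof.
move=> n2 x y.
have N0 : ('C(n, 2)%:R : R) != 0 by rewrite pnatr_eq0 -lt0n bin_gt0.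
have F0 : (n`!%:R : R) != 0 by rewrite pnatr_eq0 -lt0n fact_gt0.
have le_card (k : sgraph n) : (#|edges k| <= 'C(n, 2))%N.
  by rewrite -card_pairs subset_leq_card // edges_pairs.
have /(congr1 (fun k => k%:R : R)) : ('C(n, 2) * \sum_(phi : 'S_n) disagreements g h phi
    = n`! * (#|edges g| * ('C(n, 2) - #|edges h|)
             + ('C(n, 2) - #|edges g|) * #|edges h|))%N.
  rewrite -card_pairs -sum_mem_neq ?edges_pairs // card_pairs.
  rewrite exchange_big /= !big_distrr /=; apply: eq_bigr => e he.
  exact: (sum_perm_pair (fun f => (e \in edges g) != (f \in edges h))).
rewrite !natrM natr_sum natrD !natrM !natrB // => E.
rewrite /mean_disagreements.
apply: (mulfI N0); rewrite mulrCA E /x /y; field.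
by apply/andP; split; rewrite ?N0 ?F0.
Qed.

Lemma disagreements1 n (g h : sgraph n) :
  disagreements g h 1%g = (\sum_(e in pairs n) ((e \in edges g) != (e \in edges h)))%N.
Proof.
apply: eq_bigr => e _; rewrite (_ : (_ @: e)%SET = e) //.
by under eq_imset => x do rewrite perm1; rewrite imset_id.
Qed.

Lemma strE (R : realType) n (g h : sgraph n) : (2 <= n)%N ->
  let x := ('C(n, 2)%:R)^-1 * #|edges g|%:R : R in
  let y := ('C(n, 2)%:R)^-1 * #|edges h|%:R : R in
  let D := ('C(n, 2)%:R)^-1 * (disagreements g h 1%g)%:R : R in
  0 < x * (1 - y) + (1 - x) * y ->
  str R g h 1%g = 1 - D / (x * (1 - y) + (1 - x) * y).
Proof.
move=> n2 x y D den0.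
have N0 : ('C(n, 2)%:R : R) != 0 by rewrite pnatr_eq0 -lt0n bin_gt0.
(* Two edgeless graphs give [x = y = 0] and two complete ones [x = y = 1]. Both make the denominator
   vanish, so its positivity rules out the conventional value. *)
rewrite /str ifF; last first.
  apply/negP => /orP[] /andP[/eqP eg /eqP eh]; move: den0; rewrite /x /y eg eh.
    by rewrite cards0 !(mulr0, mul0r) addr0 ltxx.
  by rewrite card_pairs mulVf // subrr !(mulr0, mul0r) addr0 ltxx.
rewrite mean_disagreementsE // -/x -/y /D; congr (1 - _).
by field; rewrite N0 lt0r_neq0.
Qed.

(** * Deterministic estimates for the ratio and the heterogeneity correlation *)

Lemma ratio_perturbation (R : realFieldType) (c mu t x y D eta : R) :
  0 < c -> c <= 2 * mu * (1 - mu) -> 0 <= mu <= 1 -> 0 <= t <= 1 ->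
  0 <= y <= 1 -> eta <= c / 4 ->
  `|x - mu| <= eta -> `|y - mu| <= eta -> `|D - t * (2 * mu * (1 - mu))| <= eta ->
  0 < x * (1 - y) + (1 - x) * y /\
  `|(1 - D / (x * (1 - y) + (1 - x) * y)) - (1 - t)| <= 6 * eta / c.
Proof.
move=> c0 cm /andP[mu0 mu1] /andP[t0 t1] /andP[y0 y1] etac hx hy hD.
set den := x * (1 - y) + (1 - x) * y.
set m := 2 * mu * (1 - mu) in cm hD.
have hden : `|den - m| <= 2 * eta.
  (* Both cofactors have absolute value at most 1, since [y] and [mu] lie in [0, 1]. *)
  have -> : den - m = (x - mu) * (1 - 2 * y) + (y - mu) * (1 - 2 * mu).
    by rewrite /den /m; ring.
  have -> : 2 * eta = eta * 1 + eta * 1 by ring.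
  rewrite (le_trans (ler_normD _ _)) // lerD // normrM ler_pM //;
    by rewrite ler_norml; apply/andP; split; lra.
(* This is where [eta <= c / 4] enters: [den >= c - 2 * eta >= c / 2]. With a numerator of at most
   [3 * eta], it yields the bound [6 * eta / c]. *)
have den_lb : c / 2 <= den by move: hden; rewrite ler_norml => /andP[]; lra.
have den0 : 0 < den by lra.
split=> //.
have -> : 1 - D / den - (1 - t) = (t * (den - m) - (D - t * m)) / den.
  by field; rewrite lt0r_neq0.
rewrite normrM normfV (gtr0_norm den0) ler_pdivrMr //.
have num : `|t * (den - m) - (D - t * m)| <= 3 * eta.
  have -> : 3 * eta = 1 * (2 * eta) + eta by ring.
  rewrite (le_trans (ler_normB _ _)) // lerD // normrM ler_pM //.
  by rewrite ger0_norm.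
apply: (le_trans num).
have eta0 : 0 <= eta by rewrite (le_trans _ hx).
have -> : 3 * eta = 6 * eta / c * (c / 2) by field; rewrite lt0r_neq0.
by rewrite ler_wpM2l // divr_ge0 ?mulr_ge0 // ltW.
Qed.

(** The variance is the mean of [p e ^+ 2] minus the squared mean, so mu (1 - mu) minus the variance
    is the mean of [p e * (1 - p e)]. This is how the heterogeneity correlation enters the expected
    number of disagreements. *)
Lemma bmean_het_correlation (R : realType) n (p : {set 'I_n} -> R) : (2 <= n)%N ->
  0 < bmean p < 1 ->
  bmean p * (1 - bmean p) * (1 - het_correlation p)
  = ('C(n, 2)%:R)^-1 * \sum_(e in pairs n) p e * (1 - p e).
Proof.
move=> n2 /andP[mu0 mu1]; set N := ('C(n, 2)%:R : R).
have N0 : N != 0 by rewrite pnatr_eq0 -lt0n bin_gt0.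
have mm0 : bmean p * (1 - bmean p) != 0 by rewrite mulf_neq0 ?lt0r_neq0 ?subr_gt0.
rewrite mulrBr mulr1 /het_correlation [X in _ - X]mulrC divfK //.
have -> : bvariance p = N^-1 * (\sum_(e in pairs n) p e ^+ 2) - bmean p ^+ 2.
  rewrite /bvariance -/N.
  under eq_bigr do rewrite sqrrB.
  rewrite big_split /= sumrB sumr_const card_pairs -mulr_natl -/N.
  have -> : \sum_(e in pairs n) (p e * bmean p) *+ 2 = (N * bmean p) * bmean p *+ 2.
    rewrite sumrMnl -mulr_suml; congr (_ * _ *+ 2).
    by rewrite /bmean -/N mulrA mulfV // mul1r.
  by field.
rewrite /bmean -/N; set S := \sum_(e in pairs n) p e.
have -> : \sum_(e in pairs n) p e * (1 - p e) = S - \sum_(e in pairs n) p e ^+ 2.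
  by rewrite -sumrB; apply: eq_bigr => e _; ring.
ring.
Qed.

(** * A strong law for rows of pairwise independent indicators *)

Section Indicators.
Context (R : realType) (d : measure_display) (T : measurableType d).
Context (P : probability T R).

Lemma indic_Lfun1 (A : set T) : measurable A -> (\1_A : T -> R) \in Lfun P 1.
Proof. by move=> mA; apply/Lfun1_integrable/integrable_indic. Qed.

Lemma covariance_indic (A B : set T) : measurable A -> measurable B ->
  covariance P \1_A \1_B = (P (A `&` B) - P A * P B)%E.
Proof.
move=> mA mB.
have AB : (\1_A : T -> R) * \1_B = \1_(A `&` B) by rewrite indicI.
rewrite covarianceE ?AB ?indic_Lfun1 ?expectation_indic //; exact: measurableI.
Qed.

Lemma centered_prod_integrable (A B : set T) : measurable A -> measurable B ->
  P.-integrable setT (fun w => ((\1_A w - fine (P A)) * (\1_B w - fine (P B)))%:E).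
Proof.
move=> mA mB.
have -> : (fun w => ((\1_A w - fine (P A)) * (\1_B w - fine (P B)))%:E) =
   EFin \o (\1_(A `&` B) \- fine (P A) \o* \1_B \- fine (P B) \o* \1_A
            \+ cst (fine (P A) * fine (P B))).
  apply/funext => w /=; congr EFin.
  by rewrite indicI /=; ring.
apply/Lfun1_integrable; have mAB := measurableI _ _ mA mB.
apply: rpredD; last exact: Lfun_cst.
by apply: rpredB; [apply: rpredB|]; rewrite ?Lfun_scale ?indic_Lfun1.
Qed.

Lemma integral_centered_prod (A B : set T) : measurable A -> measurable B ->
  (\int[P]_w ((\1_A w - fine (P A)) * (\1_B w - fine (P B)))%:E
   = P (A `&` B) - P A * P B)%E.
Proof.
move=> mA mB; rewrite -covariance_indic // unlock !expectation_indic //.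
by rewrite unlock.
Qed.

(** After expanding the square, the off-diagonal covariances vanish by pairwise independence, and
    each diagonal term is a Bernoulli variance, at most 1. *)
Lemma integral_sqr_sum_centered (I : finType) (s : {set I}) (A : I -> set T) :
  (forall i, measurable (A i)) ->
  (forall i j, i \in s -> j \in s -> i != j ->
     P (A i `&` A j) = (P (A i) * P (A j))%E) ->
  (\int[P]_w ((\sum_(i in s) (\1_(A i) w - fine (P (A i)))) ^+ 2)%:E <= #|s|%:R%:E)%E.
Proof.
move=> mA indep.
under eq_integral => w _.
  rewrite expr2 big_distrlr /= -sumEFin.
  under eq_bigr do rewrite -sumEFin.
  over.
have intf i j := centered_prod_integrable (mA i) (mA j).
rewrite integral_sum //; last first.
  by move=> i; apply: integrable_sum => // j _; exact: intf.
rewrite -sumr_const -sumEFin; apply: lee_sum => i hi.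
rewrite integral_sum //.
rewrite (bigD1 i) //= integral_centered_prod // big1 ?adde0 => [|j /andP[hj ji]].
  rewrite setIid -(fineK (fin_num_measure P _ (mA i))) -EFinM -EFinB lee_fin.
  rewrite lerBlDr (le_trans (fine_le _ _ (probability_le1 P (mA i)))) //=.
    by rewrite fin_num_measure.
  by rewrite lerDl mulr_ge0 // fine_ge0.
rewrite integral_centered_prod // indep // ?[i == _]eq_sym //.
by rewrite subee ?fin_numM ?fin_num_measure.
Qed.

(** By monotone convergence the series of the [Z n] has integral at most [C], hence is finite almost
    everywhere; the terms of a convergent series tend to 0. *)
Lemma ae_cvg0_of_summable_integral (Z : nat -> T -> R) (C : R) :
  (forall n, measurable_fun setT (Z n)) -> (forall n w, 0 <= Z n w) ->
  (forall m, (\sum_(n < m) \int[P]_w (Z n w)%:E <= C%:E)%E) ->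
  {ae P, forall w, (fun n => Z n w) @ \oo --> (0 : R)}.
Proof.
move=> mZ Z0 hC.
have mEZ n : measurable_fun [set: T] (fun w => (Z n w)%:E) by apply/measurable_EFinP.
have EZ0 n w : setT w -> (0 <= (Z n w)%:E)%E by rewrite lee_fin.
have int_fin : P.-integrable setT (fun w => \sum_(n <oo) (Z n w)%:E)%E.
  apply/integrableP; split.
    by apply: ge0_emeasurable_sum => // *; exact: EZ0.
  under eq_integral => w _.
    rewrite gee0_abs; last by apply: nneseries_ge0 => n _ _; exact: EZ0.
    over.
  rewrite integral_nneseries //.
  apply: (@le_lt_trans _ _ C%:E); last exact: ltry.
  apply: lime_le.
    by apply: is_cvg_nneseries => n _ _; apply: integral_ge0 => w Tw; exact: EZ0.
  by apply: nearW => m; rewrite big_mkord.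
have := integrable_ae measurableT int_fin.
apply: filterS => w /(_ I) fin.
apply: cvg_series_cvg_0; apply: nondecreasing_is_cvgn.
  by apply/nondecreasing_seqP => n; rewrite seriesSr lerDl; exact: Z0.
exists (fine (\sum_(n <oo) (Z n w)%:E)%E) => _ [n _ <-].
rewrite -lee_fin fineK // /series /= -sumEFin.
by apply: nneseries_lim_ge => i _ _; rewrite lee_fin.
Qed.

Lemma ae_cvg0_mean_centered (I : nat -> finType) (s : forall n, {set I n})
    (A : forall n, I n -> set T) (C : R) :
  (forall n, (0 < #|s n|)%N) ->
  (forall m, \sum_(n < m) (#|s n|%:R)^-1 <= C) ->
  (forall n i, measurable (A n i)) ->
  (forall n i j, i \in s n -> j \in s n -> i != j ->
     P (A n i `&` A n j) = (P (A n i) * P (A n j))%E) ->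
  {ae P, forall w,
    (fun n => (#|s n|%:R)^-1 * \sum_(i in s n) (\1_(A n i) w - fine (P (A n i))))
      @ \oo --> (0 : R)}.
Proof.
move=> s0 hC mA indep.
pose S n w : R := \sum_(i in s n) (\1_(A n i) w - fine (P (A n i))).
have mS n : measurable_fun setT (S n).
  rewrite /S; under eq_fun do rewrite big_mkcond.
  apply: measurable_sum => i; case: (i \in s n) => //.
  by apply: measurable_funB => //; exact: measurable_indic.
have : {ae P, forall w, (fun n => ((#|s n|%:R)^-1 * S n w) ^+ 2) @ \oo --> (0 : R)}.
  apply: (@ae_cvg0_of_summable_integral _ C) => [n|n w|m].
  - by apply: measurable_funX; apply: measurable_funM.
  - exact: sqr_ge0.
  - apply: (@le_trans _ _ (\sum_(n < m) (#|s n|%:R)^-1)%:E); last exact: hC.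
    rewrite -sumEFin; apply: lee_sum => n _.
    have N0 : (0 : R) < #|s n|%:R by rewrite ltr0n.
    under eq_integral do rewrite exprMn EFinM.
    rewrite ge0_integralZl_EFin ?sqr_ge0 //; last 2 first.
    + by move=> w _; rewrite lee_fin sqr_ge0.
    + by apply/measurable_EFinP; exact: measurable_funX.
    (* The second moment of the sum is at most [#|s n|], so that of the mean is at most its inverse,
       which is summable by [hC]. *)
    apply: (@le_trans _ _ (((#|s n|%:R^-1) ^+ 2)%:E * #|s n|%:R%:E)%E).
      apply: lee_wpmul2l; first by rewrite lee_fin sqr_ge0.
      by apply: integral_sqr_sum_centered => [i|i j]; [exact: mA|exact: indep].
    by rewrite -EFinM lee_fin expr2 -mulrA mulVf ?mulr1 // lt0r_neq0.
apply: filterS => w; rewrite -/(S _ w) => h.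
apply/cvgr0Pnorm_lt => e e0.
have /cvgr0Pnorm_lt/(_ (e ^+ 2)) := h; rewrite exprn_gt0 // => /(_ isT).
apply: filterS => n; rewrite normrX ltr_pXn2r ?nnegrE //; exact: ltW.
Qed.

End Indicators.

(** The sum telescopes: each term equals 2 (1/(n+1) - 1/(n+2)). *)
Lemma sum_inv_bin2_le2 (R : realType) m :
  \sum_(n < m) (('C(n.+2, 2)%:R)^-1 : R) <= 2.
Proof.
suff -> : \sum_(n < m) (('C(n.+2, 2)%:R)^-1 : R) = 2 * (1 - m.+1%:R^-1).
  by rewrite -[leRHS]mulr1 ler_pM2l // gerBl invr_ge0.
elim: m => [|m IH]; first by rewrite big_ord0 invr1 subrr mulr0.
rewrite big_ord_recr /= IH.
have E : ('C(m.+2, 2)%:R : R) * 2 = (m%:R + 2) * (m%:R + 1).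
  rewrite -[2]/(2`!%:R) -natrM bin_ffact !ffactnS ffactn0 muln1 natrM /= -!natr1.
  by ring.
have -> : ('C(m.+2, 2)%:R : R) = (m%:R + 2) * (m%:R + 1) / 2.
  by rewrite -E; field.
have m0 : (0 : R) <= m%:R by [].
have -> : (m.+1%:R : R) = m%:R + 1 by rewrite natr1.
have -> : (m.+2%:R : R) = m%:R + 2 by rewrite -addn2 natrD.
by field; rewrite !lt0r_neq0 //; lra.
Qed.

Lemma indic_predE (R : realType) (T : Type) (b : T -> bool) (w : T) :
  (\1_[set x | b x] w : R) = (b w)%:R.
Proof. by rewrite indicE; congr ((nat_of_bool _)%:R); apply/idP/idP; rewrite inE. Qed.

Lemma sum_indic_edge_event (R : realType) d (T : measurableType d) n
    (K : T -> sgraph n) (w : T) :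
  \sum_(e in pairs n) (\1_(edge_event K e) w : R) = #|edges (K w)|%:R.
Proof.
under eq_bigr do rewrite indic_predE.
by rewrite -natr_sum sum_mem_subset // edges_pairs.
Qed.

(** * Probabilities and independence of edge and disagreement events *)

Section CorrelatedBernoulli.
Context (R : realType) (d : measure_display) (T : measurableType d).
Context (P : probability T R) (n : nat) (rhoe : R) (p : {set 'I_n} -> R).
Context (G H : T -> sgraph n) (cb : correlated_bernoulli P rhoe p G H).

Definition disagreement_event (e : {set 'I_n}) : set T :=
  [set w | (e \in edges (G w)) != (e \in edges (H w))].

Lemma disagreement_eventE e : disagreement_event e =
  (edge_event G e `\` edge_event H e) `|` (edge_event H e `\` edge_event G e).
Proof.
apply/seteqP; split => w; rewrite /disagreement_event /edge_event /=;
  case: (e \in edges (G w)); case: (e \in edges (H w)) => //=; try by [left|right].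
- by case=> -[].
- by case=> -[].
Qed.

(** This extends measurability to every index [e], as [ae_cvg0_mean_centered] requires. *)
Lemma edge_event_notin_pairs (K : T -> sgraph n) e :
  e \notin pairs n -> edge_event K e = set0.
Proof.
move=> ne; apply/seteqP; split => // w /= he; case/negP: ne.
exact: (fintype.subsetP (edges_pairs (K w))).
Qed.

Lemma measurable_edge_eventG e : measurable (edge_event G e).
Proof.
have [/(cb_measG cb) //|/edge_event_notin_pairs ->] := boolP (e \in pairs n).
exact: measurable0.
Qed.

Lemma measurable_edge_eventH e : measurable (edge_event H e).
Proof.
have [/(cb_measH cb) //|/edge_event_notin_pairs ->] := boolP (e \in pairs n).
exact: measurable0.
Qed.

Lemma measurable_disagreement_event e : measurable (disagreement_event e).
Proof.
have mG := measurable_edge_eventG; have mH := measurable_edge_eventH.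
by rewrite disagreement_eventE; apply: measurableU; apply: measurableD.
Qed.

(** Mutual independence restricted to the two-element family {e, f}. Varying [B] covers the edges of
    [G], the edges of [H] and the disagreements at once. *)
Lemma pairwise_independence (B : set (bool * bool)) (e f : {set 'I_n}) :
  let Z e w := (e \in edges (G w), e \in edges (H w)) in
  e \in pairs n -> f \in pairs n -> e != f ->
  measurable (Z e @^-1` B) -> measurable (Z f @^-1` B) ->
  P (Z e @^-1` B `&` Z f @^-1` B) = (P (Z e @^-1` B) * P (Z f @^-1` B))%E.
Proof.
move=> Z he hf ef mZe mZf.
have sub : [set e; f]%SET \subset pairs n.
  by apply/fintype.subsetP => x /set2P[] ->.
have := cb_independence cb (fun=> B) sub.
rewrite big_setU1 ?finset.inE //= big_set1 EFinM !fineK ?fin_num_measure // => <-.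
congr (P _); apply/seteqP; split=> [w [ZeB ZfB] i /= /set2P[] -> //|w h].
by split; apply: h; rewrite /= !finset.inE eqxx ?orbT.
Qed.

(** For [0 < p e < 1] both variances are [p e * (1 - p e)], so the covariance is [rhoe] times that.
    At 0 and 1 the correlation is not prescribed, and the formula is checked directly. *)
Lemma prob_both_edges e : e \in pairs n ->
  P (edge_event G e `&` edge_event H e) = (p e ^+ 2 + rhoe * (p e * (1 - p e)))%:E.
Proof.
move=> he.
have mG := measurable_edge_eventG e; have mH := measurable_edge_eventH e.
have PG := cb_bernoulliG cb he; have PH := cb_bernoulliH cb he.
have /andP[p0 p1] := cb_p cb he.
have mI := measurableI _ _ mG mH.
have fI := fin_num_measure P _ mI.
have [pe0|pe0] := eqVneq (p e) 0.
  rewrite pe0 expr0n mul0r mulr0 addr0; apply/eqP; rewrite eq_le measure_ge0 andbT.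
  by rewrite -[leRHS]/(0%:E) -pe0 -PG; apply: le_measure; rewrite ?inE.
have [pe1|pe1] := eqVneq (p e) 1.
  rewrite pe1 subrr !mulr0 addr0 expr1n.
  (* The complement is the union of two null events. *)
  have : P (~` (edge_event G e `&` edge_event H e)) = 0%E.
    apply/eqP; rewrite eq_le measure_ge0 andbT setCI.
    apply: (@le_trans _ _ (P (~` edge_event G e) + P (~` edge_event H e))%E).
      by apply: measureU2; exact: measurableC.
    by rewrite !probability_setC // PG PH pe1 -EFinB subrr adde0.
  rewrite probability_setC // -(fineK fI) -EFinB => -[] /eqP.
  by rewrite subr_eq0 => /eqP <-.
have p01 : 0 < p e < 1 by rewrite !lt_neqAle eq_sym pe0 p0 pe1 p1.
have /andP[p0' p1'] := p01.
have q0 : 0 < p e * (1 - p e) by rewrite mulr_gt0 // subr_gt0.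
have := cb_correlation cb he p01; rewrite /pearson /variance !covariance_indic //.
rewrite !setIid PG PH -(fineK fI) /= -expr2.
have -> : p e - p e * p e = p e * (1 - p e) by ring.
rewrite sqrtr_sqr (gtr0_norm q0) => <-.
by rewrite divfK ?lt0r_neq0 //; congr EFin; ring.
Qed.

(** Each of the two disjoint differences has probability [p e] minus that of [prob_both_edges],
    namely [(1 - rhoe) * (p e * (1 - p e))]. *)
Lemma prob_disagreement e : e \in pairs n ->
  P (disagreement_event e) = (2 * (1 - rhoe) * (p e * (1 - p e)))%:E.
Proof.
move=> he.
have mG := measurable_edge_eventG e; have mH := measurable_edge_eventH e.
rewrite disagreement_eventE measureU; try exact: measurableD; last first.
  by apply/seteqP; split=> // w [[_ nH] [/nH]].
have finP (A : set T) : measurable A -> (P A < +oo)%E.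
  by move=> mA; rewrite (le_lt_trans (probability_le1 P mA)) ?ltry.
rewrite !measureD ?finP // [X in (_ + (_ - P X))%E]setIC.
change ((P (edge_event G e) - P (edge_event G e `&` edge_event H e)) +
  (P (edge_event H e) - P (edge_event G e `&` edge_event H e)) =
  (2 * (1 - rhoe) * (p e * (1 - p e)))%:E)%E.
rewrite prob_both_edges // (cb_bernoulliG cb he) (cb_bernoulliH cb he).
by rewrite -!EFinB -EFinD; congr EFin; ring.
Qed.

End CorrelatedBernoulli.

(** * From convergence of the three means to convergence of the strength *)

Lemma het_correlation_itv (R : realType) n (p : {set 'I_n} -> R) : (2 <= n)%N ->
  0 < bmean p < 1 -> (forall e, e \in pairs n -> 0 <= p e <= 1) ->
  0 <= 1 - het_correlation p <= 1.
Proof.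
move=> n2 mu01 p01; have /andP[mu0 mu1] := mu01.
have mm0 : 0 < bmean p * (1 - bmean p) by rewrite mulr_gt0 ?subr_gt0.
(* The lower bound comes from the mean of [p e * (1 - p e)] being nonnegative, the upper one from
   the variance being nonnegative. *)
apply/andP; split.
  rewrite -(pmulr_rge0 _ mm0) bmean_het_correlation // mulr_ge0 ?invr_ge0 //.
  apply: sumr_ge0 => e /p01 /andP[pe0 pe1].
  by rewrite mulr_ge0 // subr_ge0.
rewrite gerBl /het_correlation divr_ge0 ?(ltW mm0) // mulr_ge0 ?invr_ge0 //.
by apply: sumr_ge0 => e _; exact: sqr_ge0.
Qed.

Lemma cvg_str_of_cvg_means (R : realType) (a b : R) (n : nat -> nat)
    (g h : forall k, sgraph (n k)) (mu t : nat -> R) :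
  0 < a -> b < 1 -> (forall k, (2 <= n k)%N) ->
  (forall k, a <= mu k <= b) -> (forall k, 0 <= t k <= 1) ->
  (fun k => ('C(n k, 2)%:R)^-1 * #|edges (g k)|%:R - mu k) @ \oo --> (0 : R) ->
  (fun k => ('C(n k, 2)%:R)^-1 * #|edges (h k)|%:R - mu k) @ \oo --> (0 : R) ->
  (fun k => ('C(n k, 2)%:R)^-1 * (disagreements (g k) (h k) 1%g)%:R
            - t k * (2 * mu k * (1 - mu k))) @ \oo --> (0 : R) ->
  (fun k => str R (g k) (h k) 1%g - (1 - t k)) @ \oo --> (0 : R).
Proof.
move=> a0 b1 n2 mu_ab t01 hg hh hD.
(* A lower bound for 2 mu (1 - mu), uniform in [k]. *)
pose c := 2 * a * (1 - b).
have c0 : 0 < c by rewrite !mulr_gt0 ?subr_gt0.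
apply/cvgr0Pnorm_lt => e e0.
(* The first bound is the one [ratio_perturbation] asks for; the second makes its error
   [6 * eta / c] at most [e / 2]. *)
pose eta := Num.min (c / 4) (c * e / 12).
have eta0 : 0 < eta by rewrite lt_min !divr_gt0 // mulr_gt0.
have etac : eta <= c / 4 by rewrite ge_min lexx.
have etae : 6 * eta / c < e.
  rewrite ltr_pdivrMr //; apply: (@le_lt_trans _ _ (6 * (c * e / 12))).
    by rewrite ler_pM2l // ge_min lexx orbT.
  by have := mulr_gt0 c0 e0; lra.
move/cvgr0Pnorm_le : hD => /(_ _ eta0); move/cvgr0Pnorm_le : hh => /(_ _ eta0).
move/cvgr0Pnorm_le : hg => /(_ _ eta0); apply: filterS3 => k hg hh hD.
have /andP[amu mub] := mu_ab k.
have y01 : 0 <= (('C(n k, 2)%:R)^-1 * #|edges (h k)|%:R : R) <= 1.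
  apply/andP; split; first exact: mulr_ge0.
  rewrite mulrC ler_pdivrMr ?ltr0n ?bin_gt0 //.
  by rewrite mul1r ler_nat -card_pairs subset_leq_card // edges_pairs.
have mu01 : 0 <= mu k <= 1 by apply/andP; split; lra.
have cm : c <= 2 * mu k * (1 - mu k).
  by rewrite /c -!mulrA ler_pM2l // ler_pM //; lra.
have [den0 bound] := ratio_perturbation c0 cm mu01 (t01 k) y01 etac hg hh hD.
by rewrite strE //; apply: le_lt_trans etae.
Qed.

Theorem theorem4 (R : realType) (d : measure_display) (T : measurableType d)
  (P : probability T R)
  (rhoe : nat -> R) (p : forall n : nat, {set 'I_n} -> R)
  (G H : forall n : nat, T -> sgraph n)
  (a b : R) (ha : 0 < a) (hab : a <= b) (hb : b < 1)
  (hmu : forall n : nat, (2 <= n)%N -> a <= bmean (p n) <= b)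
  (hGH : forall n : nat, (2 <= n)%N ->
    correlated_bernoulli P (rhoe n) (p n) (G n) (H n)) :
  {ae P, forall w : T,
    (fun n : nat => str R (G n w) (H n w) 1%g
                    - total_correlation (p n) (rhoe n)) @ \oo --> (0 : R)}.
Proof.
(* Indices are shifted by 2, so that the hypotheses apply to every term and no set of pairs is
   empty; [cvg_shiftn] undoes the shift in the limit. *)
pose I n : finType := {set 'I_n.+2}.
pose s n : {set I n} := pairs n.+2.
have cb n := hGH n.+2 isT.
have sC n : #|s n| = 'C(n.+2, 2) := card_pairs n.+2.
have s0 n : (0 < #|s n|)%N by rewrite sC bin_gt0.
have hC m : \sum_(n < m) (#|s n|%:R)^-1 <= (2 : R).
  by under eq_bigr do rewrite sC; exact: sum_inv_bin2_le2.
have mG n (e : I n) : measurable (edge_event (G n.+2) e).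
  exact: measurable_edge_eventG (cb n) e.
have mH n (e : I n) : measurable (edge_event (H n.+2) e).
  exact: measurable_edge_eventH (cb n) e.
have mD n (e : I n) : measurable (disagreement_event (G n.+2) (H n.+2) e).
  exact: measurable_disagreement_event (cb n) e.
pose indep n := pairwise_independence (cb n).
have aeG := ae_cvg0_mean_centered s0 hC mG (fun n e f he hf ef =>
  indep n [set v : bool * bool | v.1] e f he hf ef (mG n e) (mG n f)).
have aeH := ae_cvg0_mean_centered s0 hC mH (fun n e f he hf ef =>
  indep n [set v : bool * bool | v.2] e f he hf ef (mH n e) (mH n f)).
have aeD := ae_cvg0_mean_centered s0 hC mD (fun n e f he hf ef =>
  indep n [set v : bool * bool | v.1 != v.2] e f he hf ef (mD n e) (mD n f)).
move: aeG aeH aeD; apply: filterS3 => w cvgG cvgH cvgD.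
rewrite -(cvg_shiftn 2) /=.
pose mu n := bmean (p n.+2).
(* Chosen so that [1 - t n] is the total correlation by definition. *)
pose t n := (1 - rhoe n.+2) * (1 - het_correlation (p n.+2)).
have mu01 n : 0 < mu n < 1.
  have /andP[amu mub] := hmu n.+2 isT.
  by rewrite (lt_le_trans ha amu) (le_lt_trans mub hb).
have t01 n : 0 <= t n <= 1.
  have /andP[r0 r1] := cb_rhoe (cb n).
  have /andP[h0 h1] := het_correlation_itv (isT : (2 <= n.+2)%N) (mu01 n) (cb_p (cb n)).
  have q0 : 0 <= 1 - rhoe n.+2 by rewrite subr_ge0.
  by rewrite mulr_ge0 //= mulr_ile1 // gerBl.
under eq_cvg => n do rewrite addn2.
apply: (@cvg_str_of_cvg_means _ a b _ (fun n => G n.+2 w)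
  (fun n => H n.+2 w) mu t) => //.
- by move=> n; exact: hmu.
- apply: cvg_trans cvgG; apply: near_eq_cvg; apply: nearW => n.
  rewrite sC sumrB mulrBr sum_indic_edge_event; congr (_ - _ * _).
  by apply: eq_bigr => e he; rewrite (cb_bernoulliG (cb n) he).
- apply: cvg_trans cvgH; apply: near_eq_cvg; apply: nearW => n.
  rewrite sC sumrB mulrBr sum_indic_edge_event; congr (_ - _ * _).
  by apply: eq_bigr => e he; rewrite (cb_bernoulliH (cb n) he).
- apply: cvg_trans cvgD; apply: near_eq_cvg; apply: nearW => n.
  rewrite sC sumrB mulrBr; congr (_ * _ - _).
    rewrite disagreements1 natr_sum; apply: eq_bigr => e _.
    exact: indic_predE.
  (* The expected disagreement fraction is [2 * (1 - rhoe n.+2)] times the mean of p (1 - p), which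
     [bmean_het_correlation] turns into [t n * (2 * mu n * (1 - mu n))]. *)
  rewrite (eq_bigr (fun e => 2 * (1 - rhoe n.+2) * (p n.+2 e * (1 - p n.+2 e)))).
    rewrite -mulr_sumr mulrCA -bmean_het_correlation //; last exact: mu01.
    by rewrite /t /mu; ring.
  by move=> e he; rewrite (prob_disagreement (cb n) he).
Qed.
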